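(* Let $q$ be a prime power, let $m\le n$ and $\epsilon$ be positive integers with $m>2\epsilon$, and let $\mathbf{A}\in\mathbb{F}_q^{m\times n}$ with $\mathrm{rank}(\mathbf{A})=m$. Then the optimal linear codelength $l_{q,\mathrm{opt}}$ of the $(\mathbf{A},\epsilon)$ function update problem over $\mathbb{F}_q$ satisfies $$l_{q,\mathrm{opt}}\ \ge\ m-k_q(m,2\epsilon+1).$$
   Context: Vectors are column vectors and $\mathrm{wt}$ denotes Hamming weight. For the $(\mathbf{A},\epsilon)$ function update problem over $\mathbb{F}_q$, a matrix $\mathbf{H}\in\mathbb{F}_q^{l\times n}$ is called a valid encoder matrix of codelength $l$ if there exists a function $\mathfrak{D}:\mathbb{F}_q^l\times\mathbb{F}_q^m\to\mathbb{F}_q^m$ such that $\mathfrak{D}(\mathbf{H}(\mathbf{x}+\mathbf{e}),\mathbf{A}\mathbf{x})=\mathbf{A}(\mathbf{x}+\mathbf{e})$ for all $\mathbf{x},\mathbf{e}\in\mathbb{F}_q^n$ with $\mathrm{wt}(\mathbf{e})\le\epsilon$. The optimal linear codelength $l_{q,\mathrm{opt}}$ is the minimum $l$ for which a valid encoder matrix $\mathbf{H}\in\mathbb{F}_q^{l\times n}$ exists. For integers $N,d\ge 1$, $k_q(N,d)$ denotes the maximum dimension among all linear codes over $\mathbb{F}_q$ of blocklength $N$ and minimum distance at least $d$. *)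

(* Defs.v *)
(* MathComp *)
From HB Require Import structures.
From mathcomp Require Import all_boot all_order all_algebra.
Set Implicit Arguments.
Unset Strict Implicit.
Unset Printing Implicit Defensive.
Import GRing.Theory.
Local Open Scope ring_scope.

Definition wt (F : nzRingType) (n : nat) (x : 'cV[F]_n) : nat :=
  #|[set i | x i 0 != 0]|.

(* A boolean, since everything is finite, so that the minimum in [l_opt] can be
   taken with [ex_minn]; see [valid_encoderP] for the propositional form. *)
Definition valid_encoder (F : finFieldType) (m n l : nat) (A : 'M[F]_(m, n))
    (eps : nat) (H : 'M[F]_(l, n)) : bool :=
  [exists D : {ffun 'cV[F]_l * 'cV[F]_m -> 'cV[F]_m},
    [forall x : 'cV[F]_n, [forall (e : 'cV[F]_n | (wt e <= eps)%N),
      D (H *m (x + e), A *m x) == A *m (x + e)]]].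

Lemma valid_encoderP (F : finFieldType) (m n l : nat) (A : 'M[F]_(m, n))
    (eps : nat) (H : 'M[F]_(l, n)) :
  reflect (exists D : 'cV[F]_l -> 'cV[F]_m -> 'cV[F]_m,
             forall x e : 'cV[F]_n, (wt e <= eps)%N ->
               D (H *m (x + e)) (A *m x) = A *m (x + e))
          (valid_encoder A eps H).
Proof.
apply: (iffP existsP) => [[D /forallP HD] | [D HD]].
  exists (fun y z => D (y, z)) => x e le_e.
  by have /forall_inP/(_ e le_e)/eqP := HD x.
exists [ffun p => D p.1 p.2]; apply/forallP=> x; apply/forall_inP=> e le_e.
by rewrite ffunE HD.
Qed.

Lemma valid_encoder_exists (F : finFieldType) (m n : nat) (A : 'M[F]_(m, n))
    (eps : nat) :
  exists l, [exists H : 'M[F]_(l, n), valid_encoder A eps H].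
Proof.
exists n; apply/existsP; exists 1%:M; apply/valid_encoderP.
by exists (fun y _ => A *m y) => x e _; rewrite mul1mx.
Qed.

Definition l_opt (F : finFieldType) (m n : nat) (A : 'M[F]_(m, n))
    (eps : nat) : nat :=
  ex_minn (valid_encoder_exists A eps).

Section FiniteSubspaces.
(* For the subtype structure of {vspace vT} over matrices. *)
Import VectorInternalTheory.
HB.instance Definition _ (F : finFieldType) (vT : vectType F) :=
  [Countable of {vspace vT} by <:].
HB.instance Definition _ (F : finFieldType) (vT : vectType F) :=
  [Finite of {vspace vT} by <:].
End FiniteSubspaces.

(* The zero code satisfies this for every [d], as it has no two distinct
   codewords. *)
Definition min_dist_geq (F : finFieldType) (N d : nat)
    (C : {vspace 'cV[F]_N}) : bool :=
  [forall x in C, [forall y in C, (x != y) ==> (d <= wt (x - y))%N]].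

Definition k_max (F : finFieldType) (N d : nat) : nat :=
  \max_(C : {vspace 'cV[F]_N} | min_dist_geq d C) \dim C.

(* Main.v *)
(* For a valid encoder H, the only vector of A (ker H) of the form A w with
   wt w <= 2 eps is 0: write w as a difference of two errors of weight at most
   eps and compare what the decoder returns.  Choosing m columns of A that form
   an invertible matrix A_S, the code of all c with A_S c in A (ker H) thus has
   minimum distance at least 2 eps + 1, and its dimension is that of A (ker H),
   at least (n - l) - (n - m) = m - l. *)
Require Import Defs.
From mathcomp Require Import all_boot all_order all_algebra.
Set Implicit Arguments.
Unset Strict Implicit.
Unset Printing Implicit Defensive.
Import GRing.Theory.
Local Open Scope ring_scope.

(** The first [a] positions of the support of [w] go to [e]; the remaining ones, at most [b], go to
    [e'] with the sign changed. *)
Lemma wt_diff_split (R : nzRingType) (n a b : nat) (w : 'cV[R]_n) :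
  (wt w <= a + b)%N ->
  exists e e' : 'cV[R]_n, [/\ (wt e <= a)%N, (wt e' <= b)%N & w = e - e'].
Proof.
move=> le_w; set s := enum [set i | w i 0 != 0].
have s_size : size s = wt w by rewrite -cardE.
exists (\col_i (if i \in take a s then w i 0 else 0)).
exists (\col_i (if i \in take a s then 0 else - w i 0)); split.
- apply: leq_trans (_ : size (take a s) <= a)%N; last first.
    by rewrite size_take_min geq_minl.
  apply: leq_trans (card_size _); apply/subset_leq_card/subsetP=> i.
  by rewrite inE mxE; case: ifP => //; rewrite eqxx.
- apply: leq_trans (_ : size (drop a s) <= b)%N; last first.
    by rewrite size_drop s_size leq_subLR.
  apply: leq_trans (card_size _); apply/subset_leq_card/subsetP=> i.
  rewrite inE mxE; case: ifP => [_|it]; first by rewrite eqxx.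
  rewrite oppr_eq0 => wi; have: i \in s by rewrite mem_enum inE.
  by rewrite -{1}(cat_take_drop a s) mem_cat it.
by apply/colP=> i; rewrite !mxE; case: ifP; rewrite ?subr0 // sub0r opprK.
Qed.

Lemma valid_encoder_ker (F : finFieldType) (m n l eps : nat)
    (A : 'M[F]_(m, n)) (H : 'M[F]_(l, n)) (v w : 'cV[F]_n) :
  valid_encoder A eps H -> H *m v = 0 -> A *m v = A *m w ->
  (wt w <= 2 * eps)%N -> A *m v = 0.
Proof.
move=> /valid_encoderP[D HD] Hv Avw.
rewrite mul2n -addnn => /wt_diff_split[e [e' [le_e le_e' w_def]]].
(* The pairs [(v - w, e)] and [(0, e')] give the decoder the same input, since [A *m (v - w) = 0]
   and [H *m (v + e') = H *m e']. Hence [A *m (v + e') = A *m e']. *)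
have := HD (v - w) e le_e; have := HD 0 e' le_e'.
have -> : v - w + e = v + e' by rewrite w_def opprB addrA addrNK.
rewrite mulmxBr -Avw subrr mulmx0 add0r !mulmxDr Hv add0r => -> /eqP.
by rewrite -[X in X == _]add0r => /eqP/addIr.
Qed.

(** The support of the product lies in the image under [f] of the support of [c], whether or not [f]
    is injective. *)
Lemma wt_mulmx_colselect (R : nzRingType) (m n : nat) (f : 'I_m -> 'I_n)
    (c : 'cV[R]_m) :
  (wt (\matrix_(i, j) (i == f j)%:R *m c) <= wt c)%N.
Proof.
apply: leq_trans (leq_imset_card f [set j | c j 0 != 0]).
apply/subset_leq_card/subsetP=> i; rewrite inE; apply: contraR => i_notin.
rewrite mxE big1 // => j _; rewrite mxE; case: eqP => [ij|]; rewrite ?mul0r //.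
rewrite mul1r; apply/eqP; apply: contraR i_notin => cj.
by rewrite ij imset_f // inE.
Qed.

(** The product is the submatrix of [A] on the columns [f j]; full row rank provides [m] independent
    columns. *)
Lemma colselect_unitmx (F : fieldType) (m n : nat) (A : 'M[F]_(m, n)) :
  \rank A = m ->
  exists f : 'I_m -> 'I_n, A *m \matrix_(i, j) (i == f j)%:R \in unitmx.
Proof.
move=> rkA; have fullA : row_full A^T by rewrite /row_full mxrank_tr rkA.
exists (fullrankfun fullA); rewrite -unitmx_tr.
have -> : (A *m \matrix_(i, j) (i == fullrankfun fullA j)%:R)^T
  = rowsub (fullrankfun fullA) A^T.
  apply/matrixP=> i j; rewrite !mxE (bigD1 (fullrankfun fullA i)) //= !mxE eqxx.
  rewrite mulr1 big1 ?addr0 // => k /negPf ki.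
  by rewrite mxE ki mulr0.
exact: fullrowsub_unit.
Qed.

Lemma valid_encoder_k_max (F : finFieldType) (m n l eps : nat)
    (A : 'M[F]_(m, n)) (H : 'M[F]_(l, n)) :
  \rank A = m -> valid_encoder A eps H ->
  (m <= k_max F m (2 * eps + 1) + l)%N.
Proof.
move=> rkA Hvalid; have [f] := colselect_unitmx rkA.
set E := \matrix_(_, _) _ => AE_unit.
pose h := linfun (mulmx H : 'cV[F]_n -> 'cV[F]_l).
(* [g] gives the coordinates of [A *m v] in the basis formed by the selected columns, so it has the
   same kernel as [A], and [E] is a right inverse of it. *)
pose g := linfun (mulmx (invmx (A *m E) *m A) : 'cV[F]_n -> 'cV[F]_m).
have gE c : g (E *m c) = c.
  by rewrite lfunE /= mulmxA -[_ *m A *m E]mulmxA mulVmx // mul1mx.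
pose C := (g @: lker h)%VS.
have dimC : (m <= \dim C + l)%N.
  have gfull : limg g = fullv.
    apply/eqP; rewrite eqEsubv subvf; apply/subvP=> c _.
    by rewrite -(gE c) memv_img ?memvf.
  (* Rank-nullity for [g] on [lker h], for [h] and for [g]; the part of [lker h] killed by [g] has
     dimension at most that of [lker g], which is [n - m]. *)
  have := limg_ker_dim g (lker h); have := limg_ker_dim h fullv.
  have := limg_ker_dim g fullv; rewrite gfull !capfv !dimvf /dim /= !muln1.
  have := dimvS (subvf (limg h)); rewrite dimvf /dim /= muln1.
  have := dimvS (capvSr (lker h) (lker g)).
  rewrite -/C => le_cap le_h kg kh kC.
  rewrite -(leq_add2l (\dim (lker g))) kg -[leqLHS]kh -kC addnA.
  by rewrite leq_add ?leq_add2r.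
apply: leq_trans dimC _; rewrite leq_add2r /k_max.
apply: (bigmax_sup C) => //.
apply/forall_inP=> x xC; apply/forall_inP=> y yC; apply/implyP=> neq_xy.
have /memv_imgP[v] : x - y \in C by rewrite rpredB.
rewrite memv_ker lfunE /= => /eqP Hv xy_def.
(* If the distance were at most [2 * eps], then [w = E *m (x - y)] would force [A *m v = 0], hence
   [x - y = g v = 0]. *)
rewrite addn1 ltnNge; apply: contra neq_xy => le_xy.
have Av : A *m v = A *m (E *m (x - y)).
  by rewrite xy_def lfunE /= -mulmxA !mulmxA mulmxV // mul1mx.
have le_w := leq_trans (wt_mulmx_colselect f (x - y)) le_xy.
have := valid_encoder_ker Hvalid Hv Av le_w.
by rewrite -subr_eq0 xy_def lfunE /= -mulmxA => ->; rewrite mulmx0.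
Qed.

Theorem theorem4 (F : finFieldType) (m n eps : nat) (A : 'M[F]_(m, n))
    (hm : (0 < m)%N) (hmn : (m <= n)%N) (heps : (0 < eps)%N)
    (hmeps : (2 * eps < m)%N) (hA : \rank A = m) :
  (m - k_max F m (2 * eps + 1) <= l_opt A eps)%N.
Proof.
rewrite leq_subLR /l_opt; case: ex_minnP => l /existsP[H Hvalid] _.
exact: valid_encoder_k_max hA Hvalid.
Qed.
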